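(* Let $S$ be a set of patterns such that either no $\pi\in S$ begins with $1$, or no $\pi\in S$ begins with its largest element. Let $f_n(S)$ and $t_n(S)$ denote the number of rooted labeled forests and rooted labeled trees on $[n]$ avoiding $S$. Then $\lim_{n\to\infty}\frac{f_n(S)^{1/n}}{n}$ and $\lim_{n\to\infty}\frac{t_n(S)^{1/n}}{n}$ exist and are equal.
   Context: A rooted labeled forest on $[n]$ is an unordered forest on $n$ vertices, each component with a distinguished root, with distinct labels from $[n]$; a rooted labeled tree is a connected one. A pattern of length $k$ is a permutation $\pi$ of $[k]$; it begins with its largest element if $\pi(1)=k$. An instance of $\pi$ is a sequence of vertices $v_1,\dots,v_k$ with $v_i$ a strict ancestor of $v_{i+1}$ whose labels are in the same relative order as $\pi$; a forest avoids $S$ if it contains no instance of any pattern in $S$. *)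

(* Defs.v *)
From HB Require Import structures.
From mathcomp Require Import all_boot all_order all_algebra.
From mathcomp Require Import all_classical all_reals all_analysis.
Set Implicit Arguments. Unset Strict Implicit. Unset Printing Implicit Defensive.
Import Order.TTheory GRing.Theory Num.Theory.

(* A rooted labeled forest on [n] (vertices/labels 'I_n, label i stands for i+1)
   is given by its parent function: [p v = None] iff v is a root. *)
Definition parentfun (n : nat) := {ffun 'I_n -> option 'I_n}.

Definition up n (p : parentfun n) (x : option 'I_n) : option 'I_n := obind p x.

(* acyclicity: from every vertex, following parents leaves the vertex set
   (goes past a root) within n steps *)
Definition is_forest n (p : parentfun n) : Prop :=
  forall v : 'I_n, iter n (up p) (Some v) = None.

Definition is_tree n (p : parentfun n) : Prop :=
  is_forest p /\ #|[set v : 'I_n | p v == None]| = 1%N.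

Definition strict_anc n (p : parentfun n) (u w : 'I_n) : Prop :=
  exists m : nat, (0 < m)%N /\ iter m (up p) (Some w) = Some u.

Definition is_pattern (pi : seq nat) : Prop := perm_eq pi (iota 1 (size pi)).

Definition begins_with_1 (pi : seq nat) : Prop := head 0%N pi = 1%N.
Definition begins_with_largest (pi : seq nat) : Prop := head 0%N pi = size pi.

Definition instance n (p : parentfun n) (pi : seq nat)
    (vs : (size pi).-tuple 'I_n) : Prop :=
  (forall i j : 'I_(size pi), nat_of_ord j = (nat_of_ord i).+1 ->
     strict_anc p (tnth vs i) (tnth vs j)) /\
  (forall i j : 'I_(size pi),
     (nat_of_ord (tnth vs i) < nat_of_ord (tnth vs j))%N =
     (nth 0%N pi i < nth 0%N pi j)%N).

Definition contains n (p : parentfun n) (pi : seq nat) : Prop :=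
  exists vs : (size pi).-tuple 'I_n, @instance n p pi vs.

Definition avoids n (p : parentfun n) (S : seq nat -> Prop) : Prop :=
  forall pi, S pi -> ~ contains p pi.

Definition f_num (S : seq nat -> Prop) (n : nat) : nat :=
  #|[set p : parentfun n | `[< is_forest p /\ avoids p S >]]|.
Definition t_num (S : seq nat -> Prop) (n : nat) : nat :=
  #|[set p : parentfun n | `[< is_tree p /\ avoids p S >]]|.

(* Main.v *)
(* If no pattern starts with its smallest (resp. largest) entry, a vertex z with
   the smallest (resp. largest) label can be made the root of anything without
   creating an instance.  Given forests on n and m vertices and a splitting of
   the labels other than z, hang the second forest under z and leave the first
   one beside it; the splitting is recovered from the descendants of z, so
   f(n+m+1) >= C(n+m,n) f(n) f(m), and likewise f(n) <= t(n+1).  Hence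
   A(n) = ln (f(n-1)/(n-1)!) satisfies A(n) + A(m) <= A(n+m) + ln(n+m).
   Splitting k m into k parts of size m by repeated halving gives
   A(km) >= k (A(m) - ln(5m)), so A(n)/n tends to the supremum of
   (A(m) - ln(5m))/m.  Finally ln n! = n ln n - n + O(ln n), and t is squeezed
   between two consecutive values of f. *)
Require Import Defs.
From HB Require Import structures.
From mathcomp Require Import all_boot all_order all_algebra.
From mathcomp Require Import all_classical all_reals all_analysis.
From mathcomp Require Import ring lra zify.
Set Implicit Arguments. Unset Strict Implicit. Unset Printing Implicit Defensive.
Import Order.TTheory GRing.Theory Num.Theory numFieldNormedType.Exports.

(** * Ancestor chains and instances *)

Lemma strict_anc_trans n (p : parentfun n) u v w :
  strict_anc p u v -> strict_anc p v w -> strict_anc p u w.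
Proof.
move=> [a [a0 Ha]] [b [b0 Hb]]; exists (a + b)%N.
by rewrite addn_gt0 a0 iterD Hb.
Qed.

Lemma iter_up_None n (p : parentfun n) k : iter k (up p) None = None.
Proof. by elim: k => //= k ->. Qed.

Lemma iter_up_None_leq n (p : parentfun n) x k l :
  (k <= l)%N -> iter k (up p) x = None -> iter l (up p) x = None.
Proof. by move=> kl E; rewrite -(subnK kl) iterD E iter_up_None. Qed.

Lemma strict_anc_cons n (p : parentfun n) u w :
  strict_anc p u w ->
  exists2 x, p w = Some x & u = x \/ strict_anc p u x.
Proof.
case=> -[|m] [// _]; rewrite iterSr /=.
case: (p w) => [x|]; last by rewrite iter_up_None.
case: m => [[<-]|m H]; first by exists x => //; left.
by exists x => //; right; exists m.+1.
Qed.

Lemma strict_anc_root n (p : parentfun n) u w : p w = None -> ~ strict_anc p u w.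
Proof. by move=> pw /strict_anc_cons[x]; rewrite pw. Qed.

Lemma instance_strict_anc n (p : parentfun n) pi vs :
  @instance n p pi vs -> forall i j : 'I_(size pi), (i < j)%N ->
  strict_anc p (tnth vs i) (tnth vs j).
Proof.
move=> [Hc _] i [j]; elim: j => [//|j IH] jlt.
rewrite /= ltnS leq_eqVlt => /orP[/eqP ij|ij]; first by apply: Hc; rewrite /= ij.
have jlt' := ltnW jlt.
by apply: (strict_anc_trans (IH jlt' ij)); apply: Hc.
Qed.

(** Meant for a piece embedded in a larger forest: an instance lying wholly in the image of [e]
    comes from the piece, since [e] keeps label order and reflects ancestry. *)
Lemma contains_pullback n N (e : 'I_n -> 'I_N) (p : parentfun n) (q : parentfun N)
    pi (vs : (size pi).-tuple 'I_N) :
  (forall a b, (e a < e b)%N = (a < b)%N) ->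
  (forall a b, strict_anc q (e a) (e b) -> strict_anc p a b) ->
  instance q vs -> (forall i, exists a, tnth vs i = e a) -> contains p pi.
Proof.
move=> emono eanc [Hc Ho] /fin_all_exists[f Hf].
exists [tuple f i | i < size pi]; split=> i j.
  by rewrite !tnth_mktuple => /Hc; rewrite !Hf; apply: eanc.
by rewrite !tnth_mktuple -Ho !Hf emono.
Qed.

(** * Gluing two forests at a vertex *)

Lemma mono_ord_inj k M (e : 'I_k -> 'I_M) :
  (forall a b, (e a < e b)%N = (a < b)%N) -> injective e.
Proof.
move=> emono a b eab; apply: val_inj => /=.
by case: (ltngtP a b) => //; rewrite -emono eab ltnn.
Qed.

(** Here [odflt z] turns the roots of [p2] into children of [z], while those of [p1] stay roots. A
    vertex outside both images, such as [z] in the use made below, becomes a root. *)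
Definition glue N n m (z : 'I_N) (e1 : 'I_n -> 'I_N) (e2 : 'I_m -> 'I_N)
    (p1 : parentfun n) (p2 : parentfun m) : parentfun N :=
  [ffun v => if [pick i | e1 i == v] is Some i then omap e1 (p1 i)
     else if [pick j | e2 j == v] is Some j then Some (odflt z (omap e2 (p2 j)))
     else None].

(* A vertex that, for the sake of its label alone, cannot be the first vertex
   of an instance of a pattern of [S]. *)
Definition cannot_start (S : seq nat -> Prop) N (z : 'I_N) :=
  forall pi, S pi -> forall vs : (size pi).-tuple 'I_N,
  (forall i j : 'I_(size pi),
     (tnth vs i < tnth vs j)%N = (nth 0%N pi i < nth 0%N pi j)%N) ->
  forall i : 'I_(size pi), i = 0%N :> nat -> tnth vs i <> z.

Section Glue.
Variables (N n m : nat) (z : 'I_N) (e1 : 'I_n -> 'I_N) (e2 : 'I_m -> 'I_N).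
Hypothesis e1_mono : forall a b, (e1 a < e1 b)%N = (a < b)%N.
Hypothesis e2_mono : forall a b, (e2 a < e2 b)%N = (a < b)%N.
Hypothesis e12 : forall a b, e1 a != e2 b.
Hypothesis e1z : forall a, e1 a != z.
Hypothesis e2z : forall b, e2 b != z.
Hypothesis e12_cover : forall v, v != z -> (exists a, v = e1 a) \/ exists b, v = e2 b.

Let e1_inj : injective e1 := mono_ord_inj e1_mono.
Let e2_inj : injective e2 := mono_ord_inj e2_mono.

Variables (p1 : parentfun n) (p2 : parentfun m).
Let g := glue z e1 e2 p1 p2.

Lemma glue_l i : g (e1 i) = omap e1 (p1 i).
Proof.
rewrite ffunE; case: pickP => [i' /eqP/e1_inj -> //|/(_ i)].
by rewrite eqxx.
Qed.

Lemma glue_r j : g (e2 j) = Some (odflt z (omap e2 (p2 j))).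
Proof.
rewrite ffunE; case: pickP => [i /eqP/esym E|_].
  by have := e12 i j; rewrite E eqxx.
case: pickP => [i' /eqP/e2_inj -> //|/(_ j)]; by rewrite eqxx.
Qed.

Lemma glue_z : g z = None.
Proof.
rewrite ffunE; case: pickP => [i|_]; first by rewrite (negPf (e1z i)).
by case: pickP => // i; rewrite (negPf (e2z i)).
Qed.

Lemma iter_glue_l k i :
  iter k (up g) (Some (e1 i)) = omap e1 (iter k (up p1) (Some i)).
Proof.
by elim: k => //= k ->; case: (iter k _ _) => //= x; rewrite glue_l.
Qed.

(** A path that leaves [p2] through a root arrives at [z] and then ends; the disjunction avoids
    recording when. *)
Lemma iter_glue_r k j :
  if iter k (up p2) (Some j) is Some j' then iter k (up g) (Some (e2 j)) = Some (e2 j')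
  else iter k (up g) (Some (e2 j)) = Some z \/ iter k (up g) (Some (e2 j)) = None.
Proof.
elim: k => //= k; case: (iter k _ _) => [x ->|[] -> ] /=.
- by rewrite glue_r; case: (p2 x) => //=; left.
- by rewrite glue_z; right.
- by right.
Qed.

Lemma strict_anc_glue_l u i : strict_anc g u (e1 i) ->
  exists2 i', u = e1 i' & strict_anc p1 i' i.
Proof.
case=> k [k0]; rewrite iter_glue_l.
case E : (iter k _ _) => [x|] //= -[<-]; exists x => //; by exists k.
Qed.

Lemma strict_anc_glue_r u j : strict_anc g u (e2 j) ->
  u = z \/ exists2 j', u = e2 j' & strict_anc p2 j' j.
Proof.
case=> k [k0]; have := iter_glue_r k j.
case E : (iter k _ _) => [x|].
  by move=> -> [<-]; right; exists x => //; exists k.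
by case=> -> // [->]; left.
Qed.

Lemma strict_anc_glue_z u : ~ strict_anc g u z.
Proof. exact/strict_anc_root/glue_z. Qed.

Lemma glue_forest : (n < N)%N -> (m < N)%N ->
  is_forest p1 -> is_forest p2 -> is_forest g.
Proof.
move=> nN mN F1 F2 v.
have [->|/e12_cover[[a ->]|[b ->]]] := eqVneq v z.
- apply: (@iter_up_None_leq _ _ _ 1) => /=; last exact: glue_z.
  exact: leq_ltn_trans nN.
- by apply: (iter_up_None_leq (ltnW nN)); rewrite iter_glue_l F1.
(* After [m] steps the path is at [z] or beyond, so [m.+1] steps suffice. *)
- apply: (iter_up_None_leq mN) => /=.
  by have := iter_glue_r m b; rewrite F2 => -[->|->] //=; rewrite glue_z.
Qed.

(** One step before first leaving [p2], the path from [j] is at a root of [p2], whose parent is now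
    [z]. *)
Lemma strict_anc_z_glue_r j : is_forest p2 -> strict_anc g z (e2 j).
Proof.
move=> F2; have : exists k, iter k (up p2) (Some j) == None by exists m; rewrite F2.
move/ex_minnP => [[//|k] /eqP Hk kmin]; exists k.+1; split=> //.
move: Hk (iter_glue_r k j) => /=.
case: (iter k _ _) (kmin k) => [x|/(_ (eqxx _))]; last by rewrite ltnn.
by move=> _ /= p2x -> /=; rewrite glue_r p2x.
Qed.

(** An instance misses [z]: a root can only come first, and [cannot_start] forbids that. The other
    entries are ancestors of the last one, so they lie in the same piece as it does. *)
Lemma glue_avoids (S : seq nat -> Prop) :
  ~ S [::] -> cannot_start S z -> avoids p1 S -> avoids p2 S -> avoids g S.
Proof.
move=> Snil Sz A1 A2 pi Spi.
have pi0 : (0 < size pi)%N by case: pi Spi.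
move=> [vs Hvs].
have vz i : tnth vs i != z.
  apply/eqP; case: i => -[|i] ilt Ei; first exact: (Sz _ Spi vs (proj2 Hvs) _ _ Ei).
  have := instance_strict_anc Hvs (i := Ordinal (ltnW ilt)) (j := Ordinal ilt) (leqnn _).
  by rewrite Ei; apply: strict_anc_glue_z.
have llt : ((size pi).-1 < size pi)%N by rewrite prednK.
set l := Ordinal llt.
have ancl i : i != l -> strict_anc g (tnth vs i) (tnth vs l).
  move=> il; apply: (instance_strict_anc Hvs).
  by rewrite ltn_neqAle il /= -ltnS prednK.
case: (e12_cover (vz l)) => -[a Ea].
- apply: (A1 _ Spi); apply: (contains_pullback e1_mono _ Hvs).
    by move=> x y /strict_anc_glue_l[x' /e1_inj ->].
  move=> i; have [->|/ancl] := eqVneq i l; first by exists a.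
  by rewrite Ea => /strict_anc_glue_l[x -> _]; exists x.
- apply: (A2 _ Spi); apply: (contains_pullback e2_mono _ Hvs).
    move=> x y /strict_anc_glue_r[/eqP|[x' /e2_inj -> //]].
    by rewrite (negPf (e2z x)).
  move=> i; have [->|/ancl] := eqVneq i l; first by exists a.
  rewrite Ea => /strict_anc_glue_r[/eqP|]; first by rewrite (negPf (vz i)).
  by case=> x -> _; exists x.
Qed.

End Glue.

Lemma glue_inj N n m (z : 'I_N) (e1 : 'I_n -> 'I_N) (e2 : 'I_m -> 'I_N) p1 p2 q1 q2 :
  (forall a b, (e1 a < e1 b)%N = (a < b)%N) ->
  (forall a b, (e2 a < e2 b)%N = (a < b)%N) ->
  (forall a b, e1 a != e2 b) -> (forall b, e2 b != z) ->
  glue z e1 e2 p1 p2 = glue z e1 e2 q1 q2 -> p1 = q1 /\ p2 = q2.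
Proof.
move=> m1 m2 e12 e2z E; split; apply/ffunP => v.
  have := congr1 (fun g : parentfun N => g (e1 v)) E; rewrite /= !glue_l //.
  exact/inj_omap/(mono_ord_inj m1).
have := congr1 (fun g : parentfun N => g (e2 v)) E; rewrite /= !glue_r //.
case: (p2 v) => [x|]; case: (q2 v) => [y|] //= [].
- by move=> xy; rewrite (mono_ord_inj m2 xy).
- by move/eqP; rewrite (negPf (e2z _)).
- by move/esym/eqP; rewrite (negPf (e2z _)).
Qed.

(** * Splitting the label set *)

(** The increasing enumeration of [A]; the default [z] is never reached when [#|A| = n]. *)
Definition ord_emb N (A : {set 'I_N}) (z : 'I_N) n (i : 'I_n) : 'I_N := nth z (enum A) i.

Lemma ord_emb_in N (A : {set 'I_N}) z n (i : 'I_n) : #|A| = n -> ord_emb A z i \in A.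
Proof. by move=> An; rewrite -mem_enum mem_nth // -cardE An. Qed.

Lemma ord_emb_surj N (A : {set 'I_N}) z n v :
  #|A| = n -> v \in A -> exists i : 'I_n, v = ord_emb A z i.
Proof.
rewrite -mem_enum => An vA; have := vA; rewrite -index_mem -cardE An => lt.
by exists (Ordinal lt); rewrite /ord_emb nth_index.
Qed.

Lemma ord_emb_mono N (A : {set 'I_N}) z n (a b : 'I_n) : #|A| = n ->
  (ord_emb A z a < ord_emb A z b)%N = (a < b)%N.
Proof.
move=> An.
have sA : sorted ltn (map val (enum A)).
  have -> : enum A = [seq x <- enum 'I_N | x \in A].
    by rewrite -filter_predI; apply: eq_filter => x; rewrite /= andbT.
  apply: (subseq_sorted ltn_trans) (map_subseq _ (filter_subseq _ _)) _.
  by rewrite val_enum_ord iota_ltn_sorted.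
have sz : size (map val (enum A)) = n by rewrite size_map -cardE.
have := lt_sorted_ltn_nth (val z) sA.
move/(_ a b); rewrite !inE sz !ltn_ord => /(_ isT isT) <-.
by rewrite !(nth_map z) // -cardE An.
Qed.

(** * Counting inequalities *)

Definition avoiding_forests (S : seq nat -> Prop) k : {set parentfun k} :=
  [set p | `[< is_forest p /\ avoids p S >]].

Definition avoiding_trees (S : seq nat -> Prop) k : {set parentfun k} :=
  [set p | `[< is_tree p /\ avoids p S >]].

Lemma avoiding_forestsP S k (p : parentfun k) :
  reflect (is_forest p /\ avoids p S) (p \in avoiding_forests S k).
Proof. by rewrite finset.in_set; apply: asboolP. Qed.

Lemma avoiding_treesP S k (p : parentfun k) :
  reflect (is_tree p /\ avoids p S) (p \in avoiding_trees S k).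
Proof. by rewrite finset.in_set; apply: asboolP. Qed.

Lemma f_numE S k : f_num S k = #|avoiding_forests S k|. Proof. by []. Qed.

Lemma t_numE S k : t_num S k = #|avoiding_trees S k|. Proof. by []. Qed.

Section Count.
Variables (n m : nat) (z : 'I_(n + m).+1).

Definition blocks := [set A : {set 'I_(n + m).+1} | A \subset [set~ z] & #|A| == n].
Definition glue_at A (p1 : parentfun n) (p2 : parentfun m) :=
  glue z (@ord_emb _ A z n) (@ord_emb _ (~: (z |: A)) z m) p1 p2.

Lemma blocks_spec A : A \in blocks ->
  [/\ z \notin A, #|A| = n & #|~: (z |: A)| = m].
Proof.
rewrite inE => /andP[/fintype.subsetP AC /eqP An].
have zA : z \notin A by apply/negP => /AC; rewrite !inE eqxx.
split=> //.
have := cardsC (z |: A); rewrite cardsU1 zA An card_ord /=; lia.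
Qed.

Section Facts.
Variable A : {set 'I_(n + m).+1}.
Hypothesis blockA : A \in blocks.
Let e1 : 'I_n -> 'I_(n + m).+1 := @ord_emb _ A z n.
Let e2 : 'I_m -> 'I_(n + m).+1 := @ord_emb _ (~: (z |: A)) z m.

Let An : #|A| = n. Proof. by case: (blocks_spec blockA). Qed.
Let Am : #|~: (z |: A)| = m. Proof. by case: (blocks_spec blockA). Qed.
Let zA : z \notin A. Proof. by case: (blocks_spec blockA). Qed.

Let e1_mono a b : (e1 a < e1 b)%N = (a < b)%N.
Proof. exact: ord_emb_mono. Qed.

Let e2_mono a b : (e2 a < e2 b)%N = (a < b)%N.
Proof. exact: ord_emb_mono. Qed.

Let e12 a b : e1 a != e2 b.
Proof.
have : e2 b \in ~: (z |: A) by apply: ord_emb_in.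
rewrite !inE negb_or => /andP[_].
by apply: contraNneq => <-; apply: ord_emb_in.
Qed.

Let e1z a : e1 a != z.
Proof. by apply: contraNneq zA => <-; apply: ord_emb_in. Qed.

Let e2z b : e2 b != z.
Proof. by have := ord_emb_in z b Am; rewrite !inE negb_or => /andP[]. Qed.

Let e12_cover v : v != z -> (exists a, v = e1 a) \/ exists b, v = e2 b.
Proof.
move=> vz; case: (boolP (v \in A)) => vA; first by left; apply: ord_emb_surj.
by right; apply: ord_emb_surj => //; rewrite !inE negb_or vz.
Qed.

Lemma glue_at_inj p1 p2 q1 q2 :
  glue_at A p1 p2 = glue_at A q1 q2 -> p1 = q1 /\ p2 = q2.
Proof. exact: glue_inj. Qed.

Lemma glue_at_forest p1 p2 : is_forest p1 -> is_forest p2 -> is_forest (glue_at A p1 p2).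
Proof. apply: glue_forest => //; lia. Qed.

Lemma glue_at_avoids (S : seq nat -> Prop) p1 p2 : ~ S [::] -> cannot_start S z ->
  avoids p1 S -> avoids p2 S -> avoids (glue_at A p1 p2) S.
Proof. exact: glue_avoids. Qed.

(** This recovers the block from the glued forest. Acyclicity of [p2] ensures that every vertex of
    the second piece really lies below [z]. *)
Lemma in_block_glue_at p1 p2 v : is_forest p2 ->
  v \in A <-> v <> z /\ ~ strict_anc (glue_at A p1 p2) z v.
Proof.
move=> F2; split.
  move=> vA; split=> [vz|]; first by move: zA; rewrite -vz vA.
  have [a ->] := ord_emb_surj z An vA.
  by move=> /(strict_anc_glue_l e1_mono)[i /esym/eqP]; rewrite (negPf (e1z _)).
move=> [/eqP/e12_cover[[a ->] _|[b ->] []]]; first exact: ord_emb_in.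
exact: strict_anc_z_glue_r.
Qed.

Lemma glue_at_root p1 p2 : glue_at A p1 p2 z = None.
Proof. exact: glue_z. Qed.

Lemma glue_at_not_root p1 p2 v : v \notin z |: A -> glue_at A p1 p2 v != None.
Proof.
rewrite -finset.in_setC => /(ord_emb_surj z Am)[b ->].
by rewrite /glue_at glue_r.
Qed.

End Facts.

Lemma card_blocks : #|blocks| = 'C(n + m, n).
Proof. by rewrite cards_draws cardsC1 card_ord. Qed.

Lemma f_num_super_at (S : seq nat -> Prop) : ~ S [::] -> cannot_start S z ->
  ('C(n + m, n) * f_num S n * f_num S m <= f_num S (n + m).+1)%N.
Proof.
move=> Snil Sz.
rewrite -card_blocks !f_numE -!cardsX.
rewrite -(@card_in_imset _ _ (fun x => glue_at x.1.1 x.1.2 x.2)).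
  apply/subset_leq_card/fintype.subsetP => _ /imsetP[[[A p1] p2] H ->].
  move: H; rewrite !finset.in_setX /= => /andP[/andP[HA]].
  move=> /avoiding_forestsP[F1 V1] /avoiding_forestsP[F2 V2].
  apply/avoiding_forestsP; split; first exact: glue_at_forest.
  exact: glue_at_avoids.
move=> [[A p1] p2] [[B q1] q2] /=.
rewrite !finset.in_setX /=.
move=> /andP[/andP[HA _] /avoiding_forestsP[Fp2 _]].
move=> /andP[/andP[HB _] /avoiding_forestsP[Fq2 _]] E.
(* Both blocks consist of the vertices other than [z] that do not descend from [z] in the same
   forest. *)
have AB : A = B.
  apply/setP => v; apply/idP/idP.
    by rewrite (in_block_glue_at HA p1 v Fp2) E -(in_block_glue_at HB q1 v Fq2).
  by rewrite (in_block_glue_at HB q1 v Fq2) -E -(in_block_glue_at HA p1 v Fp2).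
by move: E; rewrite -AB => /(glue_at_inj HA)[-> ->].
Qed.

End Count.

(** Gluing with the empty forest beside [z] makes [z] the only root. *)
Lemma f_num_leq_t_num S n (z : 'I_n.+1) : ~ S [::] -> cannot_start S z ->
  (f_num S n <= t_num S n.+1)%N.
Proof.
move=> Snil Sz.
have b0 : finset.set0 \in @blocks 0 n z by rewrite inE finset.sub0set cards0 eqxx.
pose p0 : parentfun 0 := [ffun=> None].
have F0 : is_forest p0 by case.
have V0 : avoids p0 S.
  move=> [|a pi] Spi [vs _] //.
  by case: (tnth vs ord0).
rewrite f_numE t_numE.
rewrite -(@card_in_imset _ _ (@glue_at 0 n z finset.set0 p0)).
  apply/subset_leq_card/fintype.subsetP => _ /imsetP[p2 H ->].
  move: H => /avoiding_forestsP[F2 V2].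
  apply/avoiding_treesP; split; last exact: (glue_at_avoids b0).
  split; first exact: (glue_at_forest b0).
  rewrite -(cards1 z); congr #|pred_of_set _|; apply/setP => v; rewrite !inE.
  have [->|vz] := eqVneq v z; first by rewrite (glue_at_root b0).
  by apply/negbTE/(glue_at_not_root b0); rewrite !inE (negPf vz).
by move=> p q _ _ /(glue_at_inj b0)[].
Qed.

Lemma t_num_leq_f_num S n : (t_num S n <= f_num S n)%N.
Proof.
rewrite f_numE t_numE; apply/subset_leq_card/fintype.subsetP => p.
by move=> /avoiding_treesP[[F _] V]; apply/avoiding_forestsP.
Qed.

Lemma f_num_leq_exp S n : (f_num S n <= n.+1 ^ n)%N.
Proof.
apply: leq_trans (max_card _) _.
by rewrite card_ffun card_option !card_ord.
Qed.

Lemma f_num0 S : ~ S [::] -> f_num S 0 = 1%N.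
Proof.
move=> Snil; apply/eqP; rewrite eqn_leq (f_num_leq_exp S 0) /= f_numE card_gt0.
apply/set0Pn; exists [ffun=> None]; apply/avoiding_forestsP; split; first by case.
by move=> [|a pi] Spi [vs _] //; case: (tnth vs ord0).
Qed.

(** The empty list is a pattern that does not begin with 1, so the hypotheses allow it; it occurs in
    every forest. *)
Lemma num_contains_nil (S : seq nat -> Prop) n :
  S [::] -> f_num S n = 0%N /\ t_num S n = 0%N.
Proof.
move=> Snil; have F0 : f_num S n = 0%N.
  rewrite f_numE; apply/eqP; rewrite cards_eq0; apply/set0Pn => -[p].
  move=> /avoiding_forestsP[_ /(_ _ Snil)]; apply.
  by exists [tuple]; split; case.
by split=> //; apply/eqP; rewrite -leqn0 -F0 t_num_leq_f_num.
Qed.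

(** Let [z] carry the extreme label. If it came first in an instance, no entry of the pattern could
    be smaller (resp. larger) than the first, which would then be 1 (resp. the largest). *)
Lemma exists_cannot_start (S : seq nat -> Prop) n :
  (forall pi, S pi -> is_pattern pi) ->
  (forall pi, S pi -> ~ begins_with_1 pi) \/
    (forall pi, S pi -> ~ begins_with_largest pi) ->
  exists z : 'I_n.+1, cannot_start S z.
Proof.
move=> Spat.
have extremal pi c : S pi -> (0 < size pi)%N -> c \in iota 1 (size pi) ->
    exists2 j, (j < size pi)%N & nth 0%N pi j = c.
  move=> /Spat/perm_mem <- _ /(nthP 0%N)[j]; by exists j.
case=> H; [exists ord0 | exists ord_max] => pi Spi vs ord i i0 vz.
- have si : (0 < size pi)%N by apply: leq_ltn_trans (ltn_ord i).
  have [|j jlt pij] := extremal pi 1%N Spi si; first by rewrite mem_iota; lia.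
  have := ord (Ordinal jlt) i; rewrite vz /= i0 ltn0 pij nth0 => /esym/negbT.
  have : head 0%N pi \in iota 1 (size pi).
    by rewrite -(perm_mem (Spat _ Spi)) -nth0 mem_nth.
  rewrite mem_iota; have := H _ Spi; rewrite /begins_with_1; lia.
- have si : (0 < size pi)%N by apply: leq_ltn_trans (ltn_ord i).
  have [|j jlt pij] := extremal pi (size pi) Spi si; first by rewrite mem_iota; lia.
  have := ord i (Ordinal jlt); rewrite vz /= i0 pij nth0 ltnNge -ltnS ltn_ord.
  move=> /esym/negbT.
  have : head 0%N pi \in iota 1 (size pi).
    by rewrite -(perm_mem (Spat _ Spi)) -nth0 mem_nth.
  rewrite mem_iota; have := H _ Spi; rewrite /begins_with_largest; lia.
Qed.

Local Open Scope ring_scope.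
Local Open Scope classical_set_scope.

(** * Estimates for logarithms and factorials *)

Section LnNat.
Variable R : realType.

Lemma ln_natM (a b : nat) : (0 < a)%N -> (0 < b)%N ->
  ln (a * b)%:R = ln a%:R + ln b%:R :> R.
Proof. by move=> a0 b0; rewrite natrM lnM // posrE ltr0n. Qed.

Lemma ler_ln_nat (a b : nat) : (0 < a)%N -> (a <= b)%N -> ln a%:R <= ln b%:R :> R.
Proof.
by move=> a0 ab; rewrite ler_ln ?ler_nat // posrE ltr0n // (leq_trans a0).
Qed.

Lemma ln_nat_ge0 (n : nat) : 0 <= ln n%:R :> R.
Proof. by case: n => [|n]; [rewrite ln0|rewrite ln_ge0 // ler1n]. Qed.

Lemma cvg_ln_div_nat : (fun n : nat => ln n%:R / n%:R : R) @ \oo --> (0 : R).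
Proof.
apply/cvgrPdist_le => e e0; near=> n.
have n0 : (0 < n)%N by near: n; exact: nbhs_infty_gt.
have n0' : 0 < n%:R :> R by rewrite ltr0n.
rewrite sub0r normrN ger0_norm; last by rewrite divr_ge0 ?ln_nat_ge0.
rewrite ler_pdivrMr //.
(* With [s] the square root of [n], [ln n = 2 * ln s <= 2 * s], so the quotient is at most
   [2 / s]. *)
set s := Num.sqrt n%:R : R.
have s0 : 0 < s by rewrite sqrtr_gt0.
have ns : n%:R = s ^+ 2 :> R by rewrite sqr_sqrtr // ltW.
have ls : ln n%:R = 2 * ln s by rewrite ns lnXn // mulr_natl.
have := ln_sublinear s0.
have : 2 / e <= s.
  rewrite -(ger0_norm (ltW (divr_gt0 (ltr0Sn R 1) e0))) -sqrtr_sqr ler_wsqrtr //.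
  by near: n; exact: nbhs_infty_ger.
rewrite ler_pdivrMr // ls ns; nra.
Unshelve. all: by end_near. Qed.

Lemma cvg_inv_nat : (fun n : nat => n%:R^-1 : R) @ \oo --> (0 : R).
Proof. by rewrite -cvg_shiftS; exact: cvg_harmonic. Qed.

(** From [x] to [y = x + 1] the middle term grows by [1 - x * (ln y - ln x)]. Since
    [1 / y <= ln y - ln x <= 1 / x], this lies between 0 and [ln y - ln x], the growth of the right
    side. *)
Lemma ln_fact_bounds n : (0 < n)%N ->
  0 <= ln (n`!%:R : R) - n%:R * ln n%:R + n%:R <= 1 + ln n%:R.
Proof.
elim: n => // -[_ _|n IH _].
  by rewrite factS fact0 ln1 mulr0 subr0 add0r addr0 lexx ler01.
have {IH} := IH isT.
rewrite (factS n.+1) ln_natM // ?fact_gt0 //.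
set x := n.+1%:R : R; set y := n.+2%:R : R; set F := ln n.+1`!%:R.
have x0 : 0 < x by rewrite ltr0n.
have yx : y = x + 1 by rewrite /x /y [n.+2%:R]mulrS addrC.
have y0 : 0 < y by rewrite ltr0n.
have h1 : ln y - ln x <= x^-1.
  rewrite -ln_div ?posrE // yx mulrDl divff ?gt_eqF // div1r.
  by apply: le_ln1Dx; apply: lt_trans (_ : 0 < _); rewrite ?invr_gt0 // ltrN10.
have h2 : y^-1 <= ln y - ln x.
  rewrite -opprB -ln_div ?posrE // lerNr.
  have -> : x / y = 1 + - y^-1.
    by rewrite -{1}[x](addrK 1) -yx mulrBl divff ?gt_eqF // div1r.
  by apply: le_ln1Dx; rewrite ltrN2 invf_lt1 // yx ltrDr.
have h3 : x * (ln y - ln x) <= 1 by rewrite mulrC -ler_pdivlMr // div1r.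
have h4 : 1 <= y * (ln y - ln x) by rewrite mulrC -ler_pdivrMr // div1r.
move: (ln y) (ln x) F h3 h4 {h1 h2} => ly lx F; rewrite {}yx => h3 h4 /andP[l1 l2].
by apply/andP; split; nra.
Qed.

End LnNat.

(** * A Fekete lemma with logarithmic error *)

Section Fekete.
Variables (R : realType) (A : nat -> R) (C : R).
Hypothesis A_super : forall n m, (0 < n)%N -> (0 < m)%N ->
  A n + A m <= A (n + m)%N + ln (n + m)%:R.
Hypothesis A_bound : forall n, (0 < n)%N -> A n <= C * n%:R.

(* The halves [i], [j] of [k >= 2] satisfy [k ^ 2 <= 5 * i * j], which lets the
   term [ln k] absorb the factor [k] lost at each halving. *)
Lemma super_mul m k : (0 < m)%N -> (0 < k)%N ->
  k%:R * A m - (k%:R - 1) * ln (5 * m)%:R + ln k%:R <= A (k * m)%N.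
Proof.
move=> m0; elim/ltn_ind: k => -[//|[|k]] IH _.
  by rewrite mul1n ln1 mul1r subrr mul0r subr0 addr0.
pose i := (k.+2)./2; pose j := (k.+2 - i)%N.
have i0 : (0 < i)%N by rewrite /i; lia.
have j0 : (0 < j)%N by rewrite /j /i; lia.
have kij : (k.+2 = i + j)%N by rewrite /j /i; lia.
have ik : (i < k.+2)%N by lia.
have jk : (j < k.+2)%N by lia.
(* The constant 4 would do only for equal halves; the halves 1 and 2 of 3 give [9 <= 10]. *)
have ij5 : (k.+2 * k.+2 <= 5 * (i * j))%N.
  have : (j = i \/ j = i.+1)%N by rewrite /j /i; lia.
  by rewrite kij => -[]->; nia.
have := ler_ln_nat R _ ij5.
rewrite !ln_natM ?muln_gt0 ?i0 ?j0 //.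
have := IH i ik i0; have := IH j jk j0.
have := A_super (n := i * m) (m := j * m).
rewrite !muln_gt0 i0 j0 m0 -mulnDl -kij !ln_natM // => /(_ isT isT).
have -> : k.+2%:R = i%:R + j%:R :> R by rewrite kij natrD.
(* The induction hypotheses use all but one of the terms [ln (5 * m)]; with [ln i + ln j], the last
   one pays for the error [ln k + ln m] and the new [ln k], where [k = i + j]. *)
move=> h1 h2 h3 /(_ isT) h4; nra.
Qed.

(** By [super_mul], [B m] bounds the mean of [A] at every multiple of [m] from below, whereas [B n]
    differs from [A n / n] only by [ln (5 * n) / n]. *)
Let B (m : nat) := (A m - ln (5 * m)%:R) / m%:R.
Let L := sup [set B m | m in [set m | (0 < m)%N]].

Lemma B_ubound : has_ubound [set B m | m in [set m | (0 < m)%N]].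
Proof.
exists C => _ [m /= m0 <-]; rewrite ler_pdivrMr ?ltr0n //.
by rewrite lerBlDr (le_trans (A_bound m0)) // lerDl ln_nat_ge0.
Qed.

Lemma B_leq m : (0 < m)%N -> B m <= L.
Proof. by move=> m0; apply: (ub_le_sup B_ubound); exists m. Qed.

Lemma super_mean_lower m : (0 < m)%N -> exists K, forall n, (0 < n)%N ->
  B m - (K / n%:R + ln n%:R / n%:R) <= A n / n%:R.
Proof.
(* This [K] covers both [B m * r] and [- A r] for every [r <= m]. *)
move=> m0; pose K := `|B m| * m%:R + \sum_(i < m.+1) `|A i|.
exists K => n n0.
rewrite -mulrDl -[X in X - _](mulfK (x := n%:R)) ?pnatr_eq0 -?lt0n // -mulrBl.
rewrite ler_pM2r ?invr_gt0 ?ltr0n //.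
(* Dividing [n.-1] puts the remainder [r] between 1 and [m], as [A_super] takes positive arguments
   only. *)
pose k := (n.-1 %/ m)%N; pose r := (n.-1 %% m).+1.
have nE : n = (k * m + r)%N by rewrite /k /r addnS -divn_eq prednK.
have rm : (r <= m)%N by rewrite /r ltn_pmod.
have Ar : - (\sum_(i < m.+1) `|A i|) <= A r.
  rewrite lerNl (bigD1 (Ordinal (rm : (r < m.+1)%N))) //=.
  apply: (@le_trans _ _ `|A r|); first by rewrite -normrN ler_norm.
  by rewrite lerDl sumr_ge0.
have Bm : B m * m%:R = A m - ln (5 * m)%:R by rewrite /B divfK // pnatr_eq0 -lt0n.
have Br : B m * r%:R <= `|B m| * m%:R.
  apply: (le_trans (ler_norm _)); rewrite normrM [`|r%:R|]ger0_norm //.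
  by rewrite ler_wpM2l // ler_nat.
have l0 : 0 <= ln n%:R :> R := ln_nat_ge0 R n.
have [k0|k0] := posnP k.
  move: nE l0 Br Ar; rewrite k0 mul0n add0n /K => <-; lra.
have := super_mul m0 k0; have := A_super (n := k * m) (m := r).
rewrite muln_gt0 k0 m0 -nE => /(_ isT isT).
have := ln_nat_ge0 R k; have := ln_nat_ge0 R (5 * m).
have -> : n%:R = k%:R * m%:R + r%:R :> R by rewrite nE natrD natrM.
have -> : B m * (k%:R * m%:R + r%:R) = k%:R * (A m - ln (5 * m)%:R) + B m * r%:R.
  by rewrite -Bm; ring.
rewrite /K; move: Ar Br l0; rewrite nE; lra.
Qed.

(** For [m] with [B m] within [e / 2] of the supremum [L], [super_mean_lower] bounds the means from
    below; [B n <= L] bounds them from above up to [ln (5 * n) / n]. *)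
Lemma fekete_ln : exists l : R, (fun n => A n / n%:R) @ \oo --> l.
Proof.
exists L; apply/cvgrPdist_le => e e0.
have e20 : 0 < e / 2 by rewrite divr_gt0.
have [|_ [m /= m0 <-] Bm] := sup_adherent e20 (E := [set B m | m in [set m | (0 < m)%N]]).
  by split; [exists (B 1%N), 1%N|exact: B_ubound].
have [K HK] := super_mean_lower m0.
have c1 : (fun n : nat => K / n%:R + ln n%:R / n%:R : R) @ \oo --> (0 : R).
  rewrite -[0 in X in _ --> X](addr0 0) -{1}(mulr0 K).
  by apply: cvgD; [apply: cvgMr; exact: cvg_inv_nat|exact: cvg_ln_div_nat].
have c2 : (fun n : nat => ln 5 / n%:R + ln n%:R / n%:R : R) @ \oo --> (0 : R).
  rewrite -[0 in X in _ --> X](addr0 0) -{1}(mulr0 (ln 5)).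
  by apply: cvgD; [apply: cvgMr; exact: cvg_inv_nat|exact: cvg_ln_div_nat].
near=> n.
have n0 : (0 < n)%N by near: n; exact: nbhs_infty_gt.
have lo := HK n n0; have := B_leq n0.
rewrite {1}/B ln_natM // mulrBl mulrDl => up.
have : `|0 - (K / n%:R + ln n%:R / n%:R)| <= e / 2.
  by near: n; exact: (cvgrPdist_le _ _).1 c1 _ e20.
have : `|0 - (ln 5 / n%:R + ln n%:R / n%:R)| <= e / 2.
  by near: n; exact: (cvgrPdist_le _ _).1 c2 _ e20.
rewrite !sub0r !normrN !ler_norml => /andP[_ h1] /andP[_ h2].
rewrite -/L in Bm; apply/andP; split; lra.
Unshelve. all: by end_near. Qed.

End Fekete.

(** * Growth rates of the two counting sequences *)

Section Growth.
Variables (R : realType) (f t : nat -> nat).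
Hypothesis f0 : f 0 = 1%N.
Hypothesis f_super : forall n m, ('C(n + m, n) * f n * f m <= f (n + m).+1)%N.
Hypothesis f_leq : forall n, (f n <= n.+1 ^ n)%N.
Hypothesis f_leq_t : forall n, (f n <= t n.+1)%N.
Hypothesis t_leq_f : forall n, (t n <= f n)%N.

Lemma growth_f_gt0 n : (0 < f n)%N.
Proof.
elim: n => [|n IH]; first by rewrite f0.
exact: leq_trans IH (leq_trans (f_leq_t n) (t_leq_f _)).
Qed.

(** The shift of index absorbs the extra vertex in [f_super]. *)
Let A (n : nat) : R := ln (f n.-1)%:R - ln (n.-1)`!%:R.

Lemma growth_super n m : (0 < n)%N -> (0 < m)%N ->
  A n + A m <= A (n + m)%N + ln (n + m)%:R.
Proof.
case: n m => [//|n] [//|m] _ _; rewrite /A addSn addnS /=.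
have : (f n * f m * (n + m)`! <= f (n + m).+1 * (n`! * m`!))%N.
  rewrite -(bin_fact (leq_addr m n)) addKn.
  by rewrite mulnA leq_mul2r [X in (X <= _)%N]mulnC mulnA f_super orbT.
move=> /(ler_ln_nat R); rewrite factS !ln_natM ?muln_gt0 ?fact_gt0 ?growth_f_gt0 // => /(_ isT).
(* Replacing [(n + m)!] by [(n + m).+1!] costs [ln (n + m).+1], less than the error allowed. *)
have := ler_ln_nat R (ltn0Sn (n + m)) (leqnSn _).
lra.
Qed.

(** The lower bound on [ln n.+1!] shows that [n * ln n.+1 - ln n!] is at most [n.+1]. *)
Lemma growth_bound n : (0 < n)%N -> A n <= 1 * n%:R.
Proof.
case: n => // n _; rewrite /A /= mul1r.
have := ler_ln_nat R (growth_f_gt0 n) (f_leq n).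
rewrite natrX lnXn ?ltr0n // -mulr_natl.
have /andP[+ _] := ln_fact_bounds R (ltn0Sn n).
rewrite factS ln_natM ?fact_gt0 // -[n.+1%:R]natr1; lra.
Qed.

Lemma growth_ln_cvg : exists l : R,
  (fun n => ln (f n)%:R / n%:R - ln n%:R : R) @ \oo --> l /\
  (fun n => ln (t n)%:R / n%:R - ln n%:R : R) @ \oo --> l.
Proof.
have [l ul] := fekete_ln growth_super growth_bound.
(* The normalized error in Stirling's formula: [ln n! / n = ln n - 1 + s n], whence the limit
   [l - 1] below. *)
pose s n : R := (ln n`!%:R - n%:R * ln n%:R + n%:R) / n%:R.
have s0 : s @ \oo --> (0 : R).
  apply: (@squeeze_cvgr _ _ _ _ (fun=> 0) (fun n => n%:R^-1 + ln n%:R / n%:R)).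
  - near=> n; have n0 : (0 < n)%N by near: n; exact: nbhs_infty_gt.
    have /andP[h1 h2] := ln_fact_bounds R n0.
    rewrite /s divr_ge0 //=.
    have -> : n%:R^-1 + ln n%:R / n%:R = (1 + ln n%:R) / n%:R :> R.
      by rewrite mulrDl div1r.
    by rewrite ler_pM2r // invr_gt0 ltr0n.
  - exact: cvg_cst.
  - rewrite -(addr0 (0 : R)); apply: cvgD; first exact: cvg_inv_nat.
    exact: cvg_ln_div_nat.
pose u n : R := A n / n%:R.
have uS : (fun n => u n.+1) @ \oo --> l by rewrite (cvg_shiftS u).
have cf : (fun n => ln (f n)%:R / n%:R - ln n%:R : R) @ \oo --> l - 1.
  (* Here [ln (f n) = A n.+1 + ln n!], and [A n.+1 / n = u n.+1 * (1 + 1 / n)]. *)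
  have : (fun n => u n.+1 + u n.+1 * n%:R^-1 + s n - 1) @ \oo --> l + l * 0 + 0 - 1.
    apply: cvgB; last exact: cvg_cst.
    apply: cvgD => //; apply: cvgD => //.
    by apply: cvgM => //; exact: cvg_inv_nat.
  rewrite mulr0 !addr0; apply: cvg_trans; apply: near_eq_cvg; near=> n.
  have n0 : (0 < n)%N by near: n; exact: nbhs_infty_gt.
  have n0' : n%:R != 0 :> R by rewrite pnatr_eq0 -lt0n.
  have n1' : n%:R + 1 != 0 :> R by rewrite natr1 pnatr_eq0.
  by rewrite /u /s /A /= -[n.+1%:R]natr1; field; rewrite n1' n0'.
exists (l - 1); split=> //.
(* For positive [n] the lower function equals [ln (f n.-1) / n - ln n]. *)
apply: (@squeeze_cvgr _ _ _ _ (fun n => u n + s n - 1 - ln n%:R / n%:R)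
          (fun n => ln (f n)%:R / n%:R - ln n%:R)) => //.
- exists 1%N => // -[//|n] _ /=; have n0 : 0 < n.+1%:R :> R by rewrite ltr0n.
  have n0' : n.+1%:R != 0 :> R by rewrite gt_eqF.
  have := ler_ln_nat R (growth_f_gt0 n) (f_leq_t n).
  have tn := leq_trans (growth_f_gt0 n) (f_leq_t n).
  have := ler_ln_nat R tn (t_leq_f n.+1) => h1 h2.
  rewrite lerD2r ler_pM2r ?invr_gt0 // h1 andbT.
  have -> : u n.+1 + s n.+1 - 1 - ln n.+1%:R / n.+1%:R
      = ln (f n)%:R / n.+1%:R - ln n.+1%:R.
    by rewrite /u /s /A /= factS ln_natM ?fact_gt0 //; field.
  by rewrite lerD2r ler_pM2r ?invr_gt0.
- rewrite -[X in _ --> X]subr0; apply: cvgB; last exact: cvg_ln_div_nat.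
  apply: cvgB; last exact: cvg_cst.
  by rewrite -[X in _ --> X]addr0; apply: cvgD.
Unshelve. all: by end_near. Qed.

End Growth.

(** Exponentiation undoes the logarithm wherever [n] and [g n] are positive. Positivity is asked
    from index 1 on because no tree has 0 vertices. *)
Lemma cvg_root_div (R : realType) (g : nat -> nat) (l : R) :
  (forall n, (0 < g n.+1)%N) ->
  (fun n => ln (g n)%:R / n%:R - ln n%:R : R) @ \oo --> l ->
  (fun n : nat => ((g n)%:R `^ (n%:R^-1)) / (n%:R : R)) @ \oo --> expR l.
Proof.
move=> g0 /(continuous_cvg _ (@continuous_expR R l)); apply: cvg_trans.
apply: near_eq_cvg; exists 1%N => // -[//|n] _ /=.
by rewrite expRB lnK ?posrE ?ltr0n // /powR gt_eqF ?ltr0n // [_^-1 * ln _]mulrC.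
Qed.

Theorem theorem1p9 (R : realType) (S : seq nat -> Prop) :
  (forall pi, S pi -> is_pattern pi) ->
  ((forall pi, S pi -> ~ begins_with_1 pi) \/
   (forall pi, S pi -> ~ begins_with_largest pi)) ->
  exists L : R,
    ((fun n : nat => ((f_num S n)%:R `^ (n%:R^-1)) / (n%:R : R)) @ \oo --> L) /\
    ((fun n : nat => ((t_num S n)%:R `^ (n%:R^-1)) / (n%:R : R)) @ \oo --> L).
Proof.
move=> Spat Sbeg; have [Snil|Snil] := pselect (S [::]).
  have E (g : nat -> nat) : (forall n, g n = 0%N) ->
      (fun n : nat => ((g n)%:R `^ (n%:R^-1)) / (n%:R : R)) @ \oo --> (0 : R).
    move=> g0; apply: cvg_near_cst; near=> n.
    (* A positive [n] makes the exponent nonzero, so that the power of 0 is 0. *)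
    have : (0 < n)%N by near: n; exact: nbhs_infty_gt.
    by move=> n0; rewrite g0 powR0 ?mul0r // invr_eq0 pnatr_eq0 -lt0n.
  by exists 0; split; apply: E => n; have [] := num_contains_nil n Snil.
have start n : exists z : 'I_n.+1, cannot_start S z by exact: exists_cannot_start.
have super n m : ('C(n + m, n) * f_num S n * f_num S m <= f_num S (n + m).+1)%N.
  by have [z Sz] := start (n + m)%N; exact: f_num_super_at Sz.
have ft n : (f_num S n <= t_num S n.+1)%N.
  by have [z Sz] := start n; exact: f_num_leq_t_num Sz.
have tf n := t_num_leq_f_num S n.
have f_gt0 := growth_f_gt0 (f_num0 Snil) ft tf.
have [l [fl tl]] := growth_ln_cvg R (f_num0 Snil) super (f_num_leq_exp S) ft tf.
exists (expR l); split; apply: cvg_root_div => // n.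
exact: leq_trans (f_gt0 n) (ft n).
Unshelve. all: by end_near. Qed.
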